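(* Let $X$ and $Y$ be real normed spaces, and let $f: X \rightarrow Y$ be a surjective phase-isometry satisfying the following conditions: (a) for every $x\in X$ and $t\in \mathbb{R}$, $f(t x)=tf(x)$ or $f(tx)=-tf(x)$; (b) for any two linearly independent vectors $x$ and $y$ in $X$, there exist two real numbers $\alpha$ and $\beta$ with $|\alpha|=|\beta|=1$ such that $f(x+y)=\alpha f(x)+\beta f(y)$. Then $f$ is phase equivalent to a linear isometry.
   Context: A mapping $f: X\to Y$ between real normed spaces is a phase-isometry if $\{\|f(x)+f(y)\|, \|f(x)-f(y)\|\}=\{\|x+y\|, \|x-y\|\}$ (equality of unordered pairs) for all $x,y\in X$. No continuity or linearity is assumed. A mapping $f:X\to Y$ is phase equivalent to a linear isometry if there exists a function $\varepsilon: X\to\{-1,1\}$ such that the map $x\mapsto \varepsilon(x)f(x)$ is a linear isometry. *)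

(* Defs.v *)
From HB Require Import structures.
From mathcomp Require Import all_boot all_order all_algebra.
From mathcomp Require Import all_classical all_reals all_analysis.

Set Implicit Arguments.
Unset Strict Implicit.
Unset Printing Implicit Defensive.

Import Order.TTheory GRing.Theory Num.Theory.
Import numFieldNormedType.Exports.

Local Open Scope classical_set_scope.
Local Open Scope ring_scope.

(* For pairs, equality of the sets {a, b} and {c, d} is the same as equality of
   the unordered pairs (multisets). *)
Definition phase_isometry (R : realType) (X Y : normedModType R)
    (f : X -> Y) : Prop :=
  forall x y : X,
    [set `|f x + f y|; `|f x - f y|] = [set `|x + y|; `|x - y|] :> set R.

(* The library's [free] is only available over finite-dimensional spaces. *)
Definition lin_indep2 (R : realType) (X : normedModType R) (x y : X) : Prop :=
  forall a b : R, a *: x + b *: y = 0 -> a = 0 /\ b = 0.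

Definition linear_isometry (R : realType) (X Y : normedModType R)
    (g : X -> Y) : Prop :=
  linear g /\ forall x : X, `|g x| = `|x|.

Definition phase_equivalent_to_linear_isometry (R : realType)
    (X Y : normedModType R) (f : X -> Y) : Prop :=
  exists eps : X -> R,
    (forall x, eps x = -1 \/ eps x = 1) /\
    linear_isometry (fun x => eps x *: f x).

(* Main.v *)
(* Fix [x0 != 0]. For each [x] there is a unique [g x] in [{f x, - f x}] such
   that [f (x0 + x) = +/- (f x0 + g x)]. Since [f] is injective up to sign, it
   maps linearly independent vectors to linearly independent vectors, and
   expanding [f] at [2 x0 + (1 + t) x] and at [x0 + x + y] in two ways and
   comparing coefficients shows that [g] is homogeneous and additive. *)
Require Import Defs.
From mathcomp Require Import all_boot all_order all_algebra.
From mathcomp Require Import all_classical all_reals all_analysis.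
From mathcomp Require Import lra.

Import Order.TTheory GRing.Theory Num.Theory.
Import numFieldNormedType.Exports.

Local Open Scope classical_set_scope.
Local Open Scope ring_scope.

Set Implicit Arguments.
Unset Strict Implicit.
Unset Printing Implicit Defensive.

(** * Equality up to sign, and comparison of coefficients *)

Definition eqpm {V : zmodType} (u v : V) : Prop := u = v \/ u = - v.

Lemma eqpm_refl (V : zmodType) (u : V) : eqpm u u.
Proof. by left. Qed.

Lemma eqpm_sym (V : zmodType) (u v : V) : eqpm u v -> eqpm v u.
Proof. by case=> ->; [left | right; rewrite opprK]. Qed.

Lemma eqpm_trans (V : zmodType) (u v w : V) : eqpm u v -> eqpm v w -> eqpm u w.
Proof.
by case=> ->; case=> ->; rewrite ?opprK; [left | right | right | left].
Qed.

Lemma eqpm_oppr (V : zmodType) (u v : V) : eqpm u v -> eqpm u (- v).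
Proof. by case=> ->; [right; rewrite opprK | left]. Qed.

Lemma eqpmZ (K : pzRingType) (V : lmodType K) (t : K) (u v : V) :
  eqpm u v -> eqpm (t *: u) (t *: v).
Proof. by case=> ->; [left | right; rewrite scalerN]. Qed.

Lemma eq_opp_eq0 (K : numFieldType) (V : lmodType K) (u : V) : u = - u -> u = 0.
Proof.
move=> /eqP; rewrite -addr_eq0 -mulr2n -scaler_nat scaler_eq0 pnatr_eq0 /=.
by move=> /eqP.
Qed.

Definition indep2 {K : pzRingType} {V : lmodType K} (p q : V) : Prop :=
  forall a b : K, a *: p + b *: q = 0 -> a = 0 /\ b = 0.

Definition indep3 {K : pzRingType} {V : lmodType K} (p q r : V) : Prop :=
  forall a b c : K, a *: p + b *: q + c *: r = 0 -> [/\ a = 0, b = 0 & c = 0].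

Lemma indep3_eqpm (K : pzRingType) (V : lmodType K) (p q r : V)
    (a b c a' b' c' : K) :
  indep3 p q r ->
  eqpm (a *: p + b *: q + c *: r) (a' *: p + b' *: q + c' *: r) ->
  [/\ a = a', b = b' & c = c'] \/ [/\ a = - a', b = - b' & c = - c'].
Proof.
move=> pqr [/eqP|/eqP].
  rewrite -subr_eq0 !opprD addrACA -scalerBl addrACA -!scalerBl => /eqP/pqr[].
  by do 3![move/eqP; rewrite subr_eq0 => /eqP ->]; left.
rewrite -addr_eq0 addrACA -scalerDl addrACA -!scalerDl => /eqP/pqr[].
by do 3![move/eqP; rewrite addr_eq0 => /eqP ->]; right.
Qed.

Lemma indep2_eqpm (K : pzRingType) (V : lmodType K) (p q : V) (a b a' b' : K) :
  indep2 p q ->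
  eqpm (a *: p + b *: q) (a' *: p + b' *: q) ->
  (a = a' /\ b = b') \/ (a = - a' /\ b = - b').
Proof.
move=> pq [/eqP|/eqP].
  rewrite -subr_eq0 opprD addrACA -!scalerBl => /eqP/pq[].
  by do 2![move/eqP; rewrite subr_eq0 => /eqP ->]; left.
rewrite -addr_eq0 addrACA -!scalerDl => /eqP/pq[].
by do 2![move/eqP; rewrite addr_eq0 => /eqP ->]; right.
Qed.

Lemma indep2P (K : fieldType) (V : lmodType K) (x y : V) :
  indep2 x y \/ exists z a b, x = a *: z /\ y = b *: z.
Proof.
have [|/existsNP[a /existsNP[b /not_implyP[]]]] := pselect (indep2 x y).
  by left.
have [-> | a0] := eqVneq a 0; last first.
  move=> /eqP; rewrite addr_eq0 => /eqP E _; right; exists y, (- (a^-1 * b)), 1.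
  by rewrite scale1r -[LHS](scalerK a0) E scalerN scalerA scaleNr.
have [-> | b0] := eqVneq b 0; first by move=> _ [].
rewrite scale0r add0r => /eqP; rewrite scaler_eq0 (negbTE b0) => /eqP -> _.
by right; exists x, 1, 0; rewrite scale1r scale0r.
Qed.

(** * Maps that are injective, homogeneous and additive up to sign *)

Section LinearUpToSign.
Context (K : realFieldType) (X Y : lmodType K) (f : X -> Y).
Hypothesis f_inj : forall x y, eqpm (f x) (f y) -> eqpm x y.
Hypothesis f_homog : forall x t, eqpm (f (t *: x)) (t *: f x).
Hypothesis f_add : forall x y, indep2 x y ->
  eqpm (f (x + y)) (f x + f y) \/ eqpm (f (x + y)) (f x - f y).

Lemma eqpm_homog (x : X) (u : Y) (t : K) :
  eqpm (f x) u -> eqpm (f (t *: x)) (t *: u).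
Proof. by move=> xu; apply: eqpm_trans (f_homog _ _) (eqpmZ _ xu). Qed.

Lemma eqpm_homogN (x : X) (u : Y) : eqpm (f x) u -> eqpm (f (- x)) u.
Proof.
move=> /(eqpm_homog (-1)); rewrite !scaleN1r => /eqpm_oppr.
by rewrite opprK.
Qed.

Lemma eqpm_inj (x y : X) (u : Y) : eqpm (f x) u -> eqpm (f y) u -> eqpm x y.
Proof. by move=> xu /eqpm_sym yu; apply: f_inj; apply: eqpm_trans xu yu. Qed.

Lemma eqpm_add_indep (x y : X) (u v : Y) : indep2 x y ->
  eqpm (f x) u -> eqpm (f y) v ->
  eqpm (f (x + y)) (u + v) \/ eqpm (f (x + y)) (u - v).
Proof.
move=> xy xu yv.
have N (w w' : Y) : eqpm (f (x + y)) (- w - w') -> eqpm (f (x + y)) (w + w').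
  by move=> /eqpm_oppr; rewrite opprD !opprK.
case: (f_add xy); case: xu => ->; case: yv => ->; rewrite ?opprK; auto.
- by rewrite -{1}[v]opprK => /N; right.
- by rewrite -{1}[v]opprK => /N; right.
Qed.

(** For independent [x], [y], each image is [u + v] or [u - v] up to sign. If both were the same,
    injectivity would give [x + y = +/- (x - y)], hence [x = 0] or [y = 0]. Dependent vectors are
    multiples of one [z], where homogeneity decides. *)
Lemma eqpm_addsub (x y : X) (u v : Y) : eqpm (f x) u -> eqpm (f y) v ->
  (eqpm (f (x + y)) (u + v) /\ eqpm (f (x - y)) (u - v)) \/
  (eqpm (f (x + y)) (u - v) /\ eqpm (f (x - y)) (u + v)).
Proof.
move=> xu yv; have [xy | [z [a [b [xE yE]]]]] := indep2P x y; last first.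
  have D : eqpm (f (x + y)) (a *: f z + b *: f z).
    by rewrite xE yE -!scalerDl; apply: f_homog.
  have B : eqpm (f (x - y)) (a *: f z - b *: f z).
    by rewrite xE yE -!scalerBl; apply: f_homog.
  have: eqpm u (a *: f z).
    by apply: eqpm_trans (eqpm_sym xu) _; rewrite xE; apply: f_homog.
  have: eqpm v (b *: f z).
    by apply: eqpm_trans (eqpm_sym yv) _; rewrite yE; apply: f_homog.
  move: (eqpm_oppr D) (eqpm_oppr B).
  by rewrite !opprD !opprK => ND NB [->|->] [->|->]; rewrite ?opprK; auto.
have xNy : indep2 x (- y).
  move=> a b; rewrite scalerN -scaleNr => /xy[-> /eqP].
  by rewrite oppr_eq0 => /eqP ->.
have NE : ~ eqpm (x + y) (x - y).
  case=> [/addrI/eq_opp_eq0 y0|].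
    have [] := xy 0 1; first by rewrite y0 scale0r scaler0 addr0.
    by move=> _ /eqP; rewrite oner_eq0.
  rewrite opprB addrC => /addrI/eq_opp_eq0 x0.
  have [] := xy 1 0; first by rewrite x0 scale0r scaler0 addr0.
  by move=> /eqP; rewrite oner_eq0.
case: (eqpm_add_indep xy xu yv) => D;
case: (eqpm_add_indep xNy xu (eqpm_homogN yv)) => B; auto;
by case: NE; apply: eqpm_inj D B.
Qed.

(** Recording the sign as a scalar [s] turns later sign questions into equations between
    coefficients. *)
Lemma eqpm_add (x y : X) (u v : Y) : eqpm (f x) u -> eqpm (f y) v ->
  exists2 s : K, s = 1 \/ s = -1 & eqpm (f (x + y)) (u + s *: v).
Proof.
move=> xu yv; case: (eqpm_addsub xu yv) => -[D _].
  by exists 1; [left | rewrite scale1r].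
by exists (-1); [right | rewrite scaleN1r].
Qed.

(** * Choosing signs relative to a nonzero base vector *)

Section BasePoint.
Context (x0 : X).
Hypothesis x0_neq0 : x0 != 0.

(* The second clause selects one of [u] and [- u], because [f x0 != 0]; it also
   makes sense when [x] is a multiple of [x0]. *)
Definition aligned (x : X) (u : Y) : Prop :=
  eqpm (f x) u /\ eqpm (f (x0 + x)) (f x0 + u).

Lemma image_base_neq0 : f x0 != 0.
Proof.
apply/eqP => fx0; have f0 : f 0 = 0.
  by have := f_homog 0 0; rewrite !scale0r; case=> ->; rewrite ?oppr0.
move/eqP: x0_neq0; apply; have [] : eqpm x0 0 by apply: f_inj; rewrite fx0 f0; left.
  by [].
by rewrite oppr0.
Qed.

(** If [u = - v], then [f x0 + u = +/- (f x0 + v)] forces [u = v] or [f x0 = 0]. *)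
Lemma aligned_uniq (x : X) (u v : Y) : aligned x u -> aligned x v -> u = v.
Proof.
move=> [xu x0u] [xv x0v].
have [//|uNv] : eqpm u v by apply: eqpm_trans (eqpm_sym xu) xv.
have [|] : eqpm (f x0 + u) (f x0 + v).
- by apply: eqpm_trans (eqpm_sym x0u) x0v.
- exact: addrI.
- rewrite uNv opprD addrC [RHS]addrC => /addrI/eq_opp_eq0/eqP.
  by rewrite (negbTE image_base_neq0).
Qed.

Lemma aligned_exists (x : X) : exists u, aligned x u.
Proof.
have [s s1 D] := eqpm_add (eqpm_refl (f x0)) (eqpm_refl (f x)).
exists (s *: f x); split=> //.
by case: s1 => ->; rewrite ?scale1r ?scaleN1r; [left | right; rewrite opprK].
Qed.

Lemma aligned_base (c : K) : aligned (c *: x0) (c *: f x0).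
Proof.
split; first exact: f_homog.
by rewrite -{1}[x0]scale1r -{1}[f x0]scale1r -!scalerDl; apply: f_homog.
Qed.

(** If [u] were a multiple of [f x0], homogeneity and injectivity up to sign would make [x] a
    multiple of [x0]. *)
Lemma indep_image (x : X) (u : Y) : eqpm (f x) u ->
  (forall c, x <> c *: x0) -> indep2 (f x0) u.
Proof.
move=> xu xN a b; have [-> | b0 E] := eqVneq b 0.
  rewrite scale0r addr0 => /eqP.
  by rewrite scaler_eq0 (negbTE image_base_neq0) orbF => /eqP.
have uE : u = (- (b^-1 * a)) *: f x0.
  move/eqP: E; rewrite addrC addr_eq0 => /eqP E.
  by rewrite -[LHS](scalerK b0) E scalerN scalerA scaleNr.
have: eqpm x ((- (b^-1 * a)) *: x0).
  by apply: eqpm_inj xu _; rewrite uE; apply: f_homog.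
by case; rewrite -?scaleNr => /xN.
Qed.

Lemma alignedZ (t : K) (x : X) (u : Y) : aligned x u -> aligned (t *: x) (t *: u).
Proof.
move=> xu; have [[c xE] | xN] := pselect (exists c, x = c *: x0).
  move: xu; rewrite xE => /aligned_uniq/(_ (aligned_base _)) ->.
  by rewrite !scalerA; apply: aligned_base.
have {}xN c : x <> c *: x0 by move=> xE; apply: xN; exists c.
case: xu => xu x0u; split; first exact: eqpm_homog.
have pu := indep_image xu xN.
have [s s1 D] := eqpm_add (eqpm_refl (f x0)) (eqpm_homog t xu).
(* The case [s = 1] is the claim. The case [s = -1] will be shown to force [t = 0], where the sign
   is irrelevant. *)
case: s1 D => -> D; first by rewrite scale1r in D.
(* The vector [2 x0 + (1 + t) x] is expanded both as [(x0 + x) + (x0 + t x)] and as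
   [(2 x0) + ((1 + t) x)]. *)
have [r r1 E] := eqpm_add x0u D.
have [q q1 F] := eqpm_add (eqpm_homog (1 + 1) (eqpm_refl (f x0)))
  (eqpm_homog (1 + t) xu).
suff t0 : t = 0 by rewrite t0 !scale0r scaler0 in D *.
rewrite addrACA -[x in x0 + _ + (x + _)]scale1r in E.
rewrite -[x0]scale1r -!scalerDl in E.
have {D E F} : eqpm ((1 + r) *: f x0 + (1 - r * t) *: u)
                    ((1 + 1) *: f x0 + (q * (1 + t)) *: u).
  apply: eqpm_trans (eqpm_trans (eqpm_sym E) _); last first.
    by move: F; rewrite scalerA.
  rewrite scale1r !scalerDr !scaleN1r scalerN !scalerBl !scalerDl !scale1r.
  by rewrite scalerA addrACA; left.
move=> /(indep2_eqpm pu).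
(* The coefficient of [f x0] gives [1 + r = +/- 2], so [r = 1] with the plus sign; then
   [1 - t = q (1 + t)] leaves only [q = 1] and [t = 0]. *)
by case: r1 => ->; case: q1 => ->; case=> -[]; lra.
Qed.

Lemma aligned_span (x : X) (u : Y) (a b : K) : aligned x u ->
  aligned (a *: x0 + b *: x) (a *: f x0 + b *: u).
Proof.
move=> xu.
(* For [c != 0], factor out [c] and align the multiple [(c^-1 * b) *: x]. The two clauses of
   [aligned] are then the cases [c = a] and [c = 1 + a]. *)
have L c : eqpm (f (c *: x0 + b *: x)) (c *: f x0 + b *: u).
  have [-> | c0] := eqVneq c 0.
    by rewrite !scale0r !add0r; case: xu => /eqpm_homog.
  have [_] := alignedZ (c^-1 * b) xu.
  move/(eqpm_homog c); rewrite !scalerDr !scalerA mulrA mulfV //.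
  by rewrite mul1r.
split; first exact: L.
by rewrite !addrA -{1}[x0]scale1r -{1}[f x0]scale1r -!scalerDl; apply: L.
Qed.

Lemma alignedD_span (x y : X) (u v : Y) : aligned x u -> aligned y v ->
  (exists a b, y = a *: x0 + b *: x) -> aligned (x + y) (u + v).
Proof.
move=> xu yv [a [b yE]].
move: yv; rewrite yE => /aligned_uniq/(_ (aligned_span a b xu)) ->.
have := aligned_span a (1 + b) xu.
by rewrite !scalerDl !scale1r addrCA [in u + _]addrCA.
Qed.

Lemma alignedD (x y : X) (u v : Y) : aligned x u -> aligned y v -> aligned (x + y) (u + v).
Proof.
move=> xu yv.
have [|yN] := pselect (exists a b, y = a *: x0 + b *: x).
  exact: alignedD_span.
(* Here [x] lies in the span of [x0] and [y], so the span case applies with [x] and [y]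
   exchanged. *)
have [[c xE]|xN] := pselect (exists c, x = c *: x0).
  rewrite addrC [u + v]addrC; apply: alignedD_span => //.
  by exists c, 0; rewrite scale0r addr0.
have pu : indep2 (f x0) u.
  by case: xu => xu _; apply: indep_image xu _ => c xE; apply: xN; exists c.
(* If [v = a' f x0 + b' u], then [f y] agrees up to sign with [f] at [a' x0 + b' x] or at
   [a' x0 - b' x]. Injectivity puts [y] in the span of [x0] and [x], against [yN]. *)
have {pu} puv : indep3 (f x0) u v.
  move=> a b c; have [-> | c0 E] := eqVneq c 0.
    by rewrite scale0r addr0 => /pu[-> ->].
  have [a' [b' vE]] : exists a' b', v = a' *: f x0 + b' *: u.
    exists (- (c^-1 * a)), (- (c^-1 * b)).
    move/eqP: E; rewrite addrC addr_eq0 => /eqP E.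
    by rewrite -[LHS](scalerK c0) E scalerN scalerDr !scalerA opprD !scaleNr.
  case: yN; case: xu => xu _; case: yv => yv _.
  rewrite vE in yv.
  case: (eqpm_addsub (f_homog x0 a') (eqpm_homog b' xu)) => -[D B].
    case: (eqpm_inj yv D) => ->; [exists a', b' | exists (- a'), (- b')] => //.
    by rewrite opprD !scaleNr.
  case: (eqpm_inj yv B) => ->; [exists a', (- b') | exists (- a'), b'].
    by rewrite scaleNr.
  by rewrite opprB addrC scaleNr.
case: xu yv => [xu x0u] [yv x0v].
(* Three expansions of [f (x0 + x + y)], grouped as [(x0 + x) + y], [(x0 + y) + x] and
   [x0 + (x + y)]. *)
have [r r1 Er] := eqpm_add x0u yv.
have [s s1 Es] := eqpm_add x0v xu.
have [t t1 Et] := eqpm_add xu yv.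
have [q q1 Eq] := eqpm_add (eqpm_refl (f x0)) Et.
rewrite (addrAC x0) (addrAC (f x0)) in Es; rewrite addrA in Eq.
have Ers : eqpm (1 *: f x0 + 1 *: u + r *: v) (1 *: f x0 + s *: u + 1 *: v).
  by rewrite !scale1r; apply: eqpm_trans (eqpm_sym Er) Es.
have Erq : eqpm (1 *: f x0 + 1 *: u + r *: v) (1 *: f x0 + q *: u + (q * t) *: v).
  rewrite !scale1r; apply: eqpm_trans (eqpm_sym Er) _.
  by rewrite -scalerA -[X in eqpm _ X]addrA -scalerDr.
(* In both comparisons [f x0] has coefficient [1] on each side, which excludes the global minus
   sign. The coefficient of [v] in [Ers] gives [r = 1]; in [Erq], [u] gives [q = 1], and then [v]
   gives [t = 1]. *)
have rE : r = 1.
  case: (indep3_eqpm puv Ers) => -[]; case: r1; lra.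
have tE : t = 1.
  case: (indep3_eqpm puv Erq) => -[].
    by move=> _ <-; rewrite mul1r rE.
  lra.
move: Er Et; rewrite rE tE !scale1r => Er Et; split=> //.
by rewrite !addrA.
Qed.

End BasePoint.

(** The map choosing the aligned value is linear by uniqueness, since the linear combination of
    aligned values is itself aligned. *)
Lemma eqpm_linear : exists2 g : X -> Y, linear g & forall x, eqpm (f x) (g x).
Proof.
have [[x0 /eqP x0_neq0]|X0] := pselect (exists x0 : X, x0 <> 0).
  have [g gP] := choice (aligned_exists x0).
  exists g; last by move=> x; case: (gP x).
  move=> a x y; apply: (aligned_uniq x0_neq0 (gP _)).
  by apply: alignedD (gP y) => //; apply: alignedZ.
(* Without a base vector [X] is the zero space, and homogeneity with factor [0] gives [f 0 = 0]. *)
exists (fun=> 0); first by move=> a x y; rewrite scaler0 addr0.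
move=> x; have -> : x = 0 *: 0.
  by rewrite scale0r; apply: contrapT => x0; apply: X0; exists x.
by rewrite -[X in eqpm _ X](scale0r (f 0)); apply: f_homog.
Qed.

End LinearUpToSign.

(** * From phase-isometries to the algebraic setting *)

Lemma phase_isometry_eqpm (R : realType) (X Y : normedModType R) (f : X -> Y) :
  phase_isometry f -> forall x y, eqpm (f x) (f y) -> eqpm x y.
Proof.
move=> f_phase x y fxy.
(* Equality up to sign is detected by [0] belonging to the pair of norms, which [f] preserves. *)
have : [set `|f x + f y|; `|f x - f y|] 0.
  by case: fxy => ->; [right | left]; rewrite ?subrr ?addNr normr0.
rewrite f_phase => -[] /esym/eqP; rewrite normr_eq0.
  by rewrite addr_eq0 => /eqP; right.
by rewrite subr_eq0 => /eqP; left.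
Qed.

(** At [y = x] the pairs of norms are the doubled norm and [0]; both inclusions are used, to cover a
    vanishing norm on either side. *)
Lemma phase_isometry_norm (R : realType) (X Y : normedModType R) (f : X -> Y) :
  phase_isometry f -> forall x, `|f x| = `|x|.
Proof.
move=> f_phase x.
have double (V : normedModType R) (v : V) : `|v + v| = `|v| + `|v|.
  by rewrite -mulr2n normrMn mulr2n.
have := f_phase x x; rewrite !subrr !normr0 !double => E.
have := normr_ge0 (f x); have := normr_ge0 x.
have : [set `|x| + `|x|; 0] (`|f x| + `|f x|) by rewrite -E; left.
have : [set `|f x| + `|f x|; 0] (`|x| + `|x|) by rewrite E; left.
by rewrite /= => -[] + []; lra.
Qed.

Unset Implicit Arguments.

Theorem proposition2p4 (R : realType) (X Y : normedModType R) (f : X -> Y)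
  (f_surj : set_surj [set: X] [set: Y] f)
  (f_phase : phase_isometry f)
  (f_hom : forall (x : X) (t : R), f (t *: x) = t *: f x \/ f (t *: x) = - (t *: f x))
  (f_add : forall x y : X, lin_indep2 x y ->
     exists alpha beta : R, [/\ `|alpha| = 1, `|beta| = 1 &
       f (x + y) = alpha *: f x + beta *: f y]) :
  phase_equivalent_to_linear_isometry f.
Proof.
(* Real scalars of absolute value [1] are signs, and the four sign patterns reduce to two up to a
   global sign. *)
have f_add_sign x y : indep2 x y ->
    eqpm (f (x + y)) (f x + f y) \/ eqpm (f (x + y)) (f x - f y).
  have norm1 (c : R) : `|c| = 1 -> c = 1 \/ c = -1.
    by case: (ger0P c) => _ <-; rewrite ?opprK; [left | right].
  move=> /f_add[a [b [/norm1 a1 /norm1 b1 ->]]].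
  case: a1 => ->; case: b1 => ->; rewrite ?scale1r ?scaleN1r.
  - by left; left.
  - by right; left.
  - by right; right; rewrite opprB addrC.
  - by left; right; rewrite opprD.
have [g g_lin fg] :=
  eqpm_linear (phase_isometry_eqpm f_phase) f_hom f_add_sign.
(* This sign turns [f] into [g]: where [f x] differs from [g x] it equals [- g x]. *)
exists (fun x => if `[< f x = g x >] then 1 else -1); split.
  by move=> x; case: ifP; [right | left].
have -> : (fun x => (if `[< f x = g x >] then 1 else -1) *: f x) = g.
  apply/funext => x; case: asboolP => [-> | fNg]; first by rewrite scale1r.
  by case: (fg x) => // ->; rewrite scaleN1r opprK.
split=> // x; rewrite -(phase_isometry_norm f_phase x).
by case: (fg x) => ->; rewrite ?normrN.
Qed.
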